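(* Let $R$ be a commutative ring, $S$ a multiplicatively closed subset of $R$, and $M$ an $R$-module. Then: (i) If $M$ is a regular fusible $R$-module and $S$ consists of regular elements of $R$, then $S^{-1}M$ is a regular fusible $S^{-1}R$-module. (ii) Suppose that $S\subseteq R-Zd(M)$ and $M$ is a faithful $R$-module. If $S^{-1}M$ is a regular fusible $S^{-1}R$-module, then $M$ is a regular fusible $R$-module.
   Context: Rings have an identity. A subset $S\subseteq R$ is multiplicatively closed if $1\in S$ and $ab\in S$ for all $a,b\in S$; it is assumed throughout that $0\notin S$. A regular element is a non zero-divisor. $M$ is faithful if $\{r\in R: Mr=0\}=0$. For a module $M$ over a ring $R$ and $m\in M$, $ann_R(m)=\{r\in R: mr=0\}$; $T_R(M)=\{m\in M: ann_R(m)\neq 0\}$ is the set of torsion elements, $T_R^{\star}(M)=\{m\in M: ann_R(m)=0\}$ the set of torsion free elements, and $Zd(M)=\{r\in R: mr=0\text{ for some }0\neq m\in M\}$. An element of $M$ is fusible if it can be written as $x+y$ with $x\in T_R(M)$ and $y\in T_R^{\star}(M)$. A nonzero $m\in M$ is regular fusible if there exists $r\in R-Zd(M)$ such that $mr$ is fusible; $M$ is a regular fusible $R$-module if every nonzero element of $M$ is regular fusible. The same definitions apply to $S^{-1}M$ over $S^{-1}R$. *)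

(* Defs.v *)
From HB Require Import structures.
From mathcomp Require Import all_boot all_algebra generic_quotient.
From mathcomp Require Import boolp classical_sets ring.

Set Implicit Arguments.
Unset Strict Implicit.
Unset Printing Implicit Defensive.

Import GRing.Theory.
Local Open Scope classical_set_scope.
Local Open Scope ring_scope.
Local Open Scope quotient_scope.

(* All rings are commutative, so the right action m r is written r *: m.
   Rings range over comPzRingType, which includes the zero ring; for a
   multiplicatively closed S : mulrClosed R (1 in S, S stable by product) the
   requirement 0 \notin S is a separate hypothesis, and excludes it. *)

Section FusibleModules.
Variables (R : comPzRingType) (M : lmodType R).

Definition ann (m : M) : set R := [set r | r *: m = 0].

Definition torsion : set M := [set m | ann m <> [set 0]].

Definition torsion_free : set M := [set m | ann m = [set 0]].

Definition Zd : set R := [set r | exists2 m : M, m != 0 & r *: m = 0].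

Definition fusible (m : M) : Prop :=
  exists x y : M, [/\ torsion x, torsion_free y & m = x + y].

Definition regular_fusible (m : M) : Prop :=
  exists r : R, ~ Zd r /\ fusible (r *: m).

Definition regular_fusible_module : Prop :=
  forall m : M, m != 0 -> regular_fusible m.

Definition faithful_module : Prop :=
  [set r : R | forall m : M, r *: m = 0] = [set 0].

End FusibleModules.

Arguments Zd {R} M.
Arguments regular_fusible_module {R} M.
Arguments faithful_module {R} M.

Definition zero_divisor (R : comPzRingType) (r : R) : Prop :=
  exists2 x : R, x != 0 & r * x = 0.

Definition regular_element (R : comPzRingType) (r : R) : Prop :=
  ~ zero_divisor r.

Section Denominators.
Variables (R : comPzRingType) (S : mulrClosed R).

Record denom : Type := Denom { den : R; denP : den \in S }.
HB.instance Definition _ := [isSub for den].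
HB.instance Definition _ := [Choice of denom by <:].

Definition denom1 : denom := Denom (rpred1 S).

Definition denomM (s t : denom) : denom := Denom (rpredM (denP s) (denP t)).

End Denominators.

Section LocalizationDef.
Variables (R : comPzRingType) (S : mulrClosed R) (M : lmodType R).

(* m/s = n/t iff u t m = u s n for some u in S; the factor u cannot be dropped,
   since S may contain zero-divisors, or act non-injectively on M. *)
Definition frac_rel (x y : M * denom S) : bool :=
  `[< exists u : denom S,
        (den u * den y.2) *: x.1 = (den u * den x.2) *: y.1 >].

Lemma frac_rel_refl : reflexive frac_rel.
Proof. by move=> x; apply/asboolP; exists (denom1 S). Qed.

Lemma frac_rel_sym : symmetric frac_rel.
Proof. by move=> x y; apply/asboolP/asboolP => -[u e]; exists u; rewrite e. Qed.

Lemma frac_rel_trans : transitive frac_rel.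
Proof.
move=> [n t] [m s] [p u] /asboolP[/= v e1] /asboolP[/= w e2].
apply/asboolP; exists (denomM (denomM v w) t) => /=.
transitivity ((den w * den u) *: ((den v * den t) *: m)).
  by rewrite scalerA; congr (_ *: _); ring.
rewrite e1; transitivity ((den v * den s) *: ((den w * den u) *: n)).
  by rewrite !scalerA; congr (_ *: _); ring.
by rewrite e2 scalerA; congr (_ *: _); ring.
Qed.

Canonical frac_equiv :=
  EquivRel frac_rel frac_rel_refl frac_rel_sym frac_rel_trans.

Definition localization : Type := {eq_quot frac_equiv}.
HB.instance Definition _ := EqQuotient.on localization.
HB.instance Definition _ := Choice.on localization.

Definition mkfrac (m : M) (s : denom S) : localization :=
  \pi_localization (m, s).

Lemma frac_eq m s n t : mkfrac m s = mkfrac n t <->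
  exists u : denom S, (den u * den t) *: m = (den u * den s) *: n.
Proof.
by split=> [/eqmodP/asboolP //|h]; apply/eqmodP/asboolP.
Qed.

Lemma frac_surj (x : localization) : exists m s, x = mkfrac m s.
Proof.
by exists (repr x).1, (repr x).2; rewrite /mkfrac -surjective_pairing reprK.
Qed.

Definition addf (x y : localization) : localization :=
  let: (m, s) := repr x in let: (n, t) := repr y in
  mkfrac (den t *: m + den s *: n) (denomM s t).

Definition oppf (x : localization) : localization :=
  let: (m, s) := repr x in mkfrac (- m) s.

Lemma repr_frac m s : exists n t,
  repr (mkfrac m s) = (n, t) /\ mkfrac n t = mkfrac m s.
Proof.
exists (repr (mkfrac m s)).1, (repr (mkfrac m s)).2.
by rewrite /mkfrac -!surjective_pairing reprK.
Qed.

Lemma addfE m s n t :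
  addf (mkfrac m s) (mkfrac n t) =
  mkfrac (den t *: m + den s *: n) (denomM s t).
Proof.
rewrite /addf; have [m' [s' [-> /frac_eq[u e1]]]] := repr_frac m s.
have [n' [t' [-> /frac_eq[v e2]]]] := repr_frac n t.
apply/frac_eq; exists (denomM u v) => /=; rewrite !scalerDr !scalerA.
congr (_ + _).
- transitivity ((den v * den t * den t') *: ((den u * den s) *: m')).
    by rewrite scalerA; congr (_ *: _); ring.
  by rewrite e1 scalerA; congr (_ *: _); ring.
- transitivity ((den u * den s * den s') *: ((den v * den t) *: n')).
    by rewrite scalerA; congr (_ *: _); ring.
  by rewrite e2 scalerA; congr (_ *: _); ring.
Qed.

Lemma oppfE m s : oppf (mkfrac m s) = mkfrac (- m) s.
Proof.
rewrite /oppf; have [m' [s' [-> /frac_eq[u e]]]] := repr_frac m s.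
by apply/frac_eq; exists u; rewrite !scalerN e.
Qed.

Lemma addfA : associative addf.
Proof.
move=> x y z; have [m [s ->]] := frac_surj x.
have [n [t ->]] := frac_surj y; have [p [u ->]] := frac_surj z.
rewrite !addfE; apply/frac_eq; exists (denom1 S) => /=.
rewrite !scalerDr !scalerA addrA.
by congr (_ *: _ + _ *: _ + _ *: _); ring.
Qed.

Lemma addfC : commutative addf.
Proof.
move=> x y; have [m [s ->]] := frac_surj x; have [n [t ->]] := frac_surj y.
rewrite !addfE; apply/frac_eq; exists (denom1 S) => /=.
by rewrite addrC !scalerDr !scalerA; congr (_ *: _ + _ *: _); ring.
Qed.

Lemma add0f : left_id (mkfrac 0 (denom1 S)) addf.
Proof.
move=> x; have [m [s ->]] := frac_surj x; rewrite addfE.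
apply/frac_eq; exists (denom1 S) => /=.
by rewrite scaler0 add0r !scalerA; congr (_ *: _); ring.
Qed.

Lemma addNf : left_inverse (mkfrac 0 (denom1 S)) oppf addf.
Proof.
move=> x; have [m [s ->]] := frac_surj x; rewrite oppfE addfE.
apply/frac_eq; exists (denom1 S) => /=.
by rewrite scalerN addNr !scaler0.
Qed.

HB.instance Definition _ :=
  GRing.isZmodule.Build localization addfA addfC add0f addNf.

End LocalizationDef.

Section ScaleFrac.
Variables (R : comPzRingType) (S : mulrClosed R).

(* S^-1 R is R localized as a module over itself; the product is the action
   (r / s) (m / t) = r m / s t below, for M := R^o. *)
Definition ring_localization : Type := localization S R^o.
HB.instance Definition _ := GRing.Zmodule.on ring_localization.

Definition mkrfrac (r : R) (s : denom S) : ring_localization :=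
  mkfrac (r : R^o) s.

Definition scalef (M : lmodType R) (a : ring_localization)
    (x : localization S M) : localization S M :=
  let: (r, s) := repr a in let: (m, t) := repr x in
  mkfrac ((r : R) *: m) (denomM s t).

Lemma scalefE (M : lmodType R) (r : R) s (m : M) t :
  scalef (mkrfrac r s) (mkfrac m t) = mkfrac (r *: m) (denomM s t).
Proof.
rewrite /scalef; have [r' [s' [-> /frac_eq[u e1]]]] := repr_frac (r : R^o) s.
have [m' [t' [-> /frac_eq[v e2]]]] := repr_frac m t.
apply/frac_eq; exists (denomM u v) => /=; rewrite !scalerA.
transitivity ((den u * den s * r') *: ((den v * den t) *: m')).
  by rewrite scalerA; congr (_ *: _); ring.
rewrite e2 [den u * den s * r']e1 scalerA; congr (_ *: _).
by rewrite /GRing.scale /=; ring.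
Qed.

Definition mulf : ring_localization -> ring_localization -> ring_localization :=
  @scalef R^o.

Lemma mulfE r s r' s' :
  mulf (mkrfrac r s) (mkrfrac r' s') = mkrfrac (r * r') (denomM s s').
Proof. exact: scalefE. Qed.

Lemma addrfE r s r' s' : mkrfrac r s + mkrfrac r' s' =
  mkrfrac (den s' * r + den s * r') (denomM s s').
Proof. exact: addfE. Qed.

Lemma ring_frac_surj (a : ring_localization) : exists r s, a = mkrfrac r s.
Proof. exact: (@frac_surj R S R^o a). Qed.

Lemma ring_frac_eq r s r' s' : mkrfrac r s = mkrfrac r' s' <->
  exists u : denom S, den u * den s' * r = den u * den s * r'.
Proof. exact: (@frac_eq R S R^o). Qed.

Lemma mulfA : associative mulf.
Proof.
move=> a b c; have [r [s ->]] := ring_frac_surj a.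
have [r' [s' ->]] := ring_frac_surj b; have [r'' [s'' ->]] := ring_frac_surj c.
rewrite !mulfE; apply/ring_frac_eq; exists (denom1 S) => /=; ring.
Qed.

Lemma mulfC : commutative mulf.
Proof.
move=> a b; have [r [s ->]] := ring_frac_surj a.
have [r' [s' ->]] := ring_frac_surj b.
rewrite !mulfE; apply/ring_frac_eq; exists (denom1 S) => /=; ring.
Qed.

Lemma mul1f : left_id (mkrfrac 1 (denom1 S)) mulf.
Proof.
move=> a; have [r [s ->]] := ring_frac_surj a.
rewrite !mulfE; apply/ring_frac_eq; exists (denom1 S) => /=; ring.
Qed.

Lemma mulfDl : left_distributive mulf +%R.
Proof.
move=> a b c; have [r [s ->]] := ring_frac_surj a.
have [r' [s' ->]] := ring_frac_surj b; have [r'' [s'' ->]] := ring_frac_surj c.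
rewrite addrfE !mulfE addrfE; apply/ring_frac_eq; exists (denom1 S) => /=; ring.
Qed.

HB.instance Definition _ :=
  GRing.Zmodule_isComPzRing.Build ring_localization mulfA mulfC mul1f mulfDl.

Section LocalizedModule.
Variable M : lmodType R.
Implicit Types (a b : ring_localization) (x y : localization S M).

Lemma scalefA a b x : scalef a (scalef b x) = scalef (a * b) x.
Proof.
have [r [s ->]] := ring_frac_surj a; have [r' [s' ->]] := ring_frac_surj b.
have [m [t ->]] := frac_surj x; rewrite [_ * _]mulfE !scalefE.
apply/frac_eq; exists (denom1 S) => /=.
by rewrite !scalerA; congr (_ *: _); ring.
Qed.

Lemma scale1f : left_id 1 (@scalef M).
Proof.
move=> x; have [m [t ->]] := frac_surj x; rewrite [1]/(mkrfrac 1 (denom1 S)).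
rewrite scalefE; apply/frac_eq; exists (denom1 S) => /=.
by rewrite !scalerA; congr (_ *: _); ring.
Qed.

Lemma scalefDr : right_distributive (@scalef M) +%R.
Proof.
move=> a x y; have [r [s ->]] := ring_frac_surj a.
have [m [t ->]] := frac_surj x; have [n [u ->]] := frac_surj y.
rewrite [mkfrac m t + _]addfE !scalefE [RHS]addfE; apply/frac_eq.
exists (denom1 S) => /=; rewrite !scalerDr !scalerA.
by congr (_ *: _ + _ *: _); ring.
Qed.

Lemma scalefDl x : {morph (@scalef M)^~ x : a b / a + b}.
Proof.
move=> a b; have [r [s ->]] := ring_frac_surj a.
have [r' [s' ->]] := ring_frac_surj b; have [m [t ->]] := frac_surj x.
rewrite addrfE !scalefE [RHS]addfE; apply/frac_eq; exists (denom1 S) => /=.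
rewrite !scalerDr !scalerA -scalerDl; congr (_ *: _); ring.
Qed.

HB.instance Definition _ :=
  GRing.Zmodule_isLmodule.Build ring_localization (localization S M)
    scalefA scale1f scalefDr scalefDl.

End LocalizedModule.
End ScaleFrac.

(* Main.v *)
Require Import Defs.
From mathcomp Require Import all_boot all_algebra.
From mathcomp Require Import boolp classical_sets.
Local Open Scope ring_scope.

Import GRing.Theory.

(** Regular fusibility is built from two conditions, on a module element and on
    a scalar, and both can be read off numerators.

    - If [S] consists of regular elements, a fraction [y / t] is torsion free
      exactly when [y] is ([torsion_free_mkfrac]): a scalar [c / w] kills
      [y / t] iff some multiple [u c], with [u] in [S], kills [y], and [c / w]
      vanishes iff [c] does. Being torsion is the negation of being torsion
      free, so torsion fractions are those with a torsion numerator.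
    - A scalar [r / s] acting non-injectively on [S^-1 M] comes from an [r]
      acting non-injectively on [M] ([Zd_mkrfracW]), and conversely when [S]
      acts injectively on [M] ([Zd_mkrfrac]).

    Part (i) thus transports a decomposition [r m = x + y] to
    [(r / 1) (m / s) = x / s + y / s]. In part (ii), faithfulness of [M] turns
    injectivity of the action of [S] into regularity of its elements, so both
    facts apply; an equality [(r / s) (m / 1) = x / t + y / v] becomes, after
    clearing denominators,
    [(u t v r) m = (u s v) x + (u s t) y] for some [u] in [S]. The scalar on the
    left still acts injectively, a multiple of a torsion element is torsion, and
    a multiple of a torsion free element by a regular scalar is torsion free. *)

Section Torsion.
Set Implicit Arguments.
Unset Strict Implicit.
Variables (R : comPzRingType) (M : lmodType R).

Lemma torsion_freeP (m : M) :
  torsion_free m <-> forall c : R, c *: m = 0 -> c = 0.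
Proof.
split=> [e c cm0|h]; first by have: ann m c by []; rewrite e.
by apply/seteqP; split=> c /= => [/h//|->]; rewrite /ann /= scale0r.
Qed.

Lemma notZdP (r : R) : ~ Zd M r <-> forall m : M, r *: m = 0 -> m = 0.
Proof.
split=> [h m rm0|h [m m_neq0 /h m0]]; last by rewrite m0 eqxx in m_neq0.
by have [//|m_neq0] := eqVneq m 0; case: h; exists m.
Qed.

Lemma regular_elementP (r : R) :
  regular_element r <-> forall c : R, r * c = 0 -> c = 0.
Proof.
split=> [h c rc0|h [c c_neq0 /h c0]]; last by rewrite c0 eqxx in c_neq0.
by have [//|c_neq0] := eqVneq c 0; case: h; exists c.
Qed.

Lemma notZdM (r s : R) : ~ Zd M r -> ~ Zd M s -> ~ Zd M (r * s).
Proof.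
by move=> /notZdP hr /notZdP hs; apply/notZdP => m; rewrite -scalerA => /hr/hs.
Qed.

Lemma torsion_freeZ (r : R) (m : M) :
  regular_element r -> torsion_free m -> torsion_free (r *: m).
Proof.
move=> /regular_elementP hr /torsion_freeP hm; apply/torsion_freeP => c.
by rewrite scalerA mulrC => /hm/hr.
Qed.

Lemma torsionZ (r : R) (m : M) : torsion m -> torsion (r *: m).
Proof.
move=> tm /torsion_freeP h; apply: tm; apply/torsion_freeP => c cm0.
by apply: h; rewrite scalerA mulrC -scalerA cm0 scaler0.
Qed.

Lemma faithful_regular (r : R) :
  faithful_module M -> ~ Zd M r -> regular_element r.
Proof.
move=> faithM /notZdP hr; apply/regular_elementP => c rc0.
have: [set d : R | forall m : M, d *: m = 0]%classic c.
  by move=> m; apply: hr; rewrite scalerA rc0 scale0r.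
by rewrite faithM.
Qed.

End Torsion.

Section Fractions.
Set Implicit Arguments.
Unset Strict Implicit.
Variables (R : comPzRingType) (S : mulrClosed R) (M : lmodType R).

Lemma mkfrac_eq0 (N : lmodType R) (m : N) (s : denom S) :
  mkfrac m s = 0 <-> exists u : denom S, den u *: m = 0.
Proof.
rewrite [0]/(mkfrac 0 (denom1 S)); split=> [/frac_eq[u]|[u um0]].
  by rewrite scaler0 mulr1 => um0; exists u.
by apply/frac_eq; exists u; rewrite scaler0 mulr1.
Qed.

Lemma mkrfrac_eq0 (r : R) (s : denom S) :
  mkrfrac r s = 0 <-> exists u : denom S, den u * r = 0.
Proof. exact: (@mkfrac_eq0 R^o). Qed.

Lemma scale_mkfrac (r : R) (s : denom S) (m : M) (t : denom S) :
  mkrfrac r s *: mkfrac m t = mkfrac (r *: m) (denomM s t).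
Proof. exact: scalefE. Qed.

Lemma mkfracD (m n : M) (s : denom S) :
  mkfrac (m + n) s = mkfrac m s + mkfrac n s.
Proof.
rewrite [RHS]addfE; apply/frac_eq; exists (denom1 S) => /=.
by rewrite -scalerDr scalerA !mul1r.
Qed.

Lemma torsion_free_mkfrac (m : M) (t : denom S) :
  (forall s : R, s \in S -> regular_element s) ->
  torsion_free (mkfrac m t : localization S M) <-> torsion_free m.
Proof.
move=> regS.
have den_reg (u : denom S) c : den u * c = 0 -> c = 0.
  by move: c; apply/regular_elementP/regS/denP.
split=> /torsion_freeP h; apply/torsion_freeP.
  move=> c cm0; have /mkrfrac_eq0[u /den_reg//] : mkrfrac c (denom1 S) = 0.
  apply: h; rewrite scale_mkfrac; apply/mkfrac_eq0.
  by exists (denom1 S); rewrite cm0 scaler0.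
move=> a; have [c [w ->]] := ring_frac_surj a.
rewrite scale_mkfrac => /mkfrac_eq0[u]; rewrite scalerA => /h uc0.
by apply/mkrfrac_eq0; exists u.
Qed.

(** If [u r n = 0] witnesses that [r / s] kills [n / t], then [u n] is the
    element killed by [r]; it is nonzero because [n / t] is. *)
Lemma Zd_mkrfracW (r : R) (s : denom S) :
  Zd (localization S M) (mkrfrac r s) -> Zd M r.
Proof.
move=> [x]; have [n [t ->]] := frac_surj x => n_neq0.
rewrite scale_mkfrac => /mkfrac_eq0[u urn0]; exists (den u *: n).
  by apply: contra_neq n_neq0 => un0; apply/mkfrac_eq0; exists u.
by rewrite scalerA mulrC -scalerA.
Qed.

Lemma mkfrac_neq0 (m : M) (t : denom S) :
  (forall s : R, s \in S -> ~ Zd M s) ->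
  m != 0 -> mkfrac m t != 0 :> localization S M.
Proof.
move=> injS; apply: contra_neq => /mkfrac_eq0[u].
by move: m; apply/notZdP/injS/denP.
Qed.

Lemma Zd_mkrfrac (r : R) (s : denom S) :
  (forall s : R, s \in S -> ~ Zd M s) ->
  Zd (localization S M) (mkrfrac r s) <-> Zd M r.
Proof.
move=> injS; split=> [|[n n_neq0 rn0]]; first exact: Zd_mkrfracW.
exists (mkfrac n (denom1 S)); first exact: mkfrac_neq0.
by rewrite scale_mkfrac rn0; apply/mkfrac_eq0; exists s; rewrite scaler0.
Qed.

Lemma regular_fusible_localization :
  (forall s : R, s \in S -> regular_element s) ->
  regular_fusible_module M ->
  @regular_fusible_module (ring_localization S) (localization S M).
Proof.
move=> regS fusM z; have [m [s ->]] := frac_surj z => ms_neq0.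
have m_neq0 : m != 0.
  apply: contra_neq ms_neq0 => ->; apply/mkfrac_eq0.
  by exists (denom1 S); rewrite scaler0.
have [r [r_inj [x [y [tx ty rm]]]]] := fusM m m_neq0.
exists (mkrfrac r (denom1 S)); split; first by move/Zd_mkrfracW.
pose t := denomM (denom1 S) s; exists (mkfrac x t), (mkfrac y t); split.
- by move/(torsion_free_mkfrac _ _ regS).
- exact/torsion_free_mkfrac.
- by rewrite scale_mkfrac rm mkfracD.
Qed.

Lemma regular_fusible_of_localization :
  (forall s : R, s \in S -> ~ Zd M s) -> faithful_module M ->
  @regular_fusible_module (ring_localization S) (localization S M) ->
  regular_fusible_module M.
Proof.
move=> injS faithM fusSM m m_neq0.
have regS s : s \in S -> regular_element s.
  by move=> /injS; apply: faithful_regular.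
have [a] := fusSM _ (mkfrac_neq0 (denom1 S) injS m_neq0).
have [r [s ->]] := ring_frac_surj a => -[rs_inj [x' [y']]].
have [x [t ->]] := frac_surj x'; have [y [v ->]] := frac_surj y' => -[tx ty].
rewrite scale_mkfrac [RHS]addfE => /frac_eq[u /= e].
exists (den u * (den t * den v) * r); split.
  apply: notZdM => [|/(Zd_mkrfrac _ s injS)//].
  exact: injS (denP (denomM u (denomM t v))).
exists ((den u * den s * den v) *: x), ((den u * den s * den t) *: y); split.
- by apply: torsionZ => /(torsion_free_mkfrac _ t regS).
- apply: torsion_freeZ; last exact/(torsion_free_mkfrac _ v regS).
  exact: regS (denP (denomM (denomM u s) t)).
- by rewrite -scalerA e mulr1 scalerDr !scalerA.
Qed.

End Fractions.

Theorem theorem1 (R : comPzRingType) (S : mulrClosed R) (M : lmodType R)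
    (S0 : (0 : R) \notin S) :
  (regular_fusible_module M ->
   (forall s : R, s \in S -> regular_element s) ->
   @regular_fusible_module (ring_localization S) (localization S M))
  /\
  ((forall s : R, s \in S -> ~ Zd M s) ->
   faithful_module M ->
   @regular_fusible_module (ring_localization S) (localization S M) ->
   regular_fusible_module M).
Proof.
split=> [fusM regS|]; first exact: regular_fusible_localization.
exact: regular_fusible_of_localization.
Qed.
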